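(* Let $\Omega$ be an additive (commutative) semigroup and $\mathbb{K}$ a field of characteristic zero. Let $A^\bullet,B^\bullet$ be symetral moulds and $C^\bullet,E^\bullet$ alternal moulds on $\Omega$ with values in $\mathbb{K}$. Then: (i) the multiplicative inverse $(A^\bullet)^{-1}$ is symetral; (ii) if $C^\bullet$ is invertible for composition, its composition inverse $(C^\bullet)^{(-1)}$ is alternal; (iii) $A^\bullet\times B^\bullet$ is symetral; (iv) $C^\bullet\circ E^\bullet$ is alternal; (v) $B^\bullet\times C^\bullet\times(B^\bullet)^{-1}$ is alternal.
   Context: $\Omega^*$ is the set of words on $\Omega$, including the empty word $\emptyset$. A mould is a map $M^\bullet:\Omega^*\to\mathbb{K}$. For non-empty $\underline{\omega}=\omega_1\dots\omega_r$, $\|\underline{\omega}\|=\omega_1+\dots+\omega_r$. Product: $(M\times N)^{\underline{\omega}}=\sum_{\underline{\omega}^1\underline{\omega}^2=\underline{\omega}}M^{\underline{\omega}^1}N^{\underline{\omega}^2}$, with unit $1^\bullet$ ($1^\emptyset=1$ and $1^{\underline{\omega}}=0$ otherwise). Composition: $(M\circ N)^{\underline{\omega}}=\sum_{s\ge0}\sum_{\underline{\omega}^1\cdots\underline{\omega}^s=\underline{\omega},\ \underline{\omega}^i\neq\emptyset}M^{(\|\underline{\omega}^1\|,\dots,\|\underline{\omega}^s\|)}N^{\underline{\omega}^1}\cdots N^{\underline{\omega}^s}$, with unit $I^\bullet$ ($I^{\underline{\omega}}=1$ if $\underline{\omega}$ has length $1$, and $0$ otherwise). A mould is invertible for composition exactly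 when $M^\emptyset=0$ and $M^\omega\ne0$ for all words $\omega$ of length 1. $\mathrm{sh}(\underline{\omega}^1,\underline{\omega}^2)$ denotes the words obtained by interleaving $\underline{\omega}^1$ and $\underline{\omega}^2$ preserving the internal order of each; sums over it run over all interleavings, with multiplicity. $M^\bullet$ is alternal if $M^\emptyset=0$ and $\sum_{\underline{\omega}\in\mathrm{sh}(\underline{\omega}^1,\underline{\omega}^2)}M^{\underline{\omega}}=0$ for all non-empty $\underline{\omega}^1,\underline{\omega}^2$. $M^\bullet$ is symetral if $M^\emptyset=1$ and $\sum_{\underline{\omega}\in\mathrm{sh}(\underline{\omega}^1,\underline{\omega}^2)}M^{\underline{\omega}}=M^{\underline{\omega}^1}M^{\underline{\omega}^2}$ for all $\underline{\omega}^1,\underline{\omega}^2\in\Omega^*$. *)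

(* Defs.v *)
From HB Require Import structures.
From mathcomp Require Import all_boot all_order all_algebra.

Set Implicit Arguments.
Unset Strict Implicit.
Unset Printing Implicit Defensive.

Import GRing.Theory.
Local Open Scope ring_scope.

Section Words.

Variable Omega : addSemigroupType.

Implicit Types (w u v : seq Omega) (d : seq (seq Omega)).

(* Omega need not have a neutral element, so the empty word has no norm. *)
Definition word_norm w : option Omega :=
  if w is x :: s then Some (foldl +%R x s) else None.

(* All the tuples of non-empty words whose concatenation is w: the first
   letter is either a block on its own or the head of the first block of a
   decomposition of the remaining letters. *)
Fixpoint word_decomps w : seq (seq (seq Omega)) :=
  if w is x :: s then
    [seq [:: x] :: d | d <- word_decomps s]
    ++ [seq (x :: head [::] d) :: behead d
       | d <- word_decomps s & d != [::]]
  else [:: [::]].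

Lemma mem_word_decomps w d :
  (d \in word_decomps w) = (flatten d == w) && ([::] \notin d).
Proof.
elim: w d => [|x s IHs] d /=.
  rewrite inE; case: d => [|[|y u] d] //=.
  by rewrite andbF.
rewrite mem_cat; apply/orP/andP => [[/mapP[e]|/mapP[e]]|].
- by rewrite IHs => /andP[/eqP <- nz] -> /=; rewrite eqxx inE.
- rewrite mem_filter IHs => /andP[+ /andP[/eqP <-]].
  case: e => [|u e] //= _; rewrite inE negb_or => /andP[_ nz] -> /=.
  by rewrite eqxx inE.
case: d => [|[|y [|z u]] d] [] //= /eqP[-> flat_d].
- rewrite inE /= => nz; left.
  by apply: map_f; rewrite IHs flat_d eqxx.
- rewrite inE /= => nz; right.
  apply/mapP; exists ((z :: u) :: d) => //.
  by rewrite mem_filter IHs /= flat_d eqxx inE.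
Qed.

Lemma uniq_word_decomps w : uniq (word_decomps w).
Proof.
elim: w => [|x s IHs] //=; rewrite cat_uniq; apply/and3P; split.
- by rewrite map_inj_uniq // => d e [].
- apply/hasPn => _ /mapP[d + ->]; rewrite mem_filter mem_word_decomps.
  case: d => [|[|y u] d] //=; first by rewrite andbF.
  by move=> _; apply/mapP => -[].
rewrite map_inj_in_uniq ?filter_uniq // => d e.
rewrite !mem_filter; case: d => [|u d] //; case: e => [|v e] // _ _ /=.
by case=> -> ->.
Qed.

(* The list, with multiplicity, of the interleavings of u and v. *)
Fixpoint shuffles u : seq Omega -> seq (seq Omega) :=
  fix shuffles_u v :=
    match u, v with
    | [::], _ => [:: v]
    | _, [::] => [:: u]
    | x :: u', y :: v' =>
        [seq x :: w | w <- shuffles u' v] ++ [seq y :: w | w <- shuffles_u v']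
    end.

End Words.

Definition mould (Omega : addSemigroupType) (K : fieldType) : Type :=
  seq Omega -> K.

Section Moulds.

Variables (Omega : addSemigroupType) (K : fieldType).

Implicit Types (M N : mould Omega K) (w u v : seq Omega).

Definition mould_one : mould Omega K := fun w => (w == [::])%:R.

Definition mould_mul M N : mould Omega K :=
  fun w => \sum_(i < (size w).+1) M (take i w) * N (drop i w).

Definition mould_id : mould Omega K := fun w => (size w == 1)%:R.

(* The blocks of d are non-empty, so pmap discards nothing. *)
Definition mould_comp M N : mould Omega K :=
  fun w => \sum_(d <- word_decomps w)
             M (pmap (@word_norm Omega) d) * \prod_(u <- d) N u.

Definition mould_mul_inverse M N : Prop :=
  mould_mul M N =1 mould_one /\ mould_mul N M =1 mould_one.

Definition mould_comp_inverse M N : Prop :=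
  mould_comp M N =1 mould_id /\ mould_comp N M =1 mould_id.

Definition alternal M : Prop :=
  M [::] = 0 /\
  forall u v, u != [::] -> v != [::] -> \sum_(w <- shuffles u v) M w = 0.

Definition symetral M : Prop :=
  M [::] = 1 /\
  forall u v, \sum_(w <- shuffles u v) M w = M u * M v.

End Moulds.

(* Main.v *)
Require Import Defs.
From mathcomp Require Import all_boot all_order all_algebra.

Set Implicit Arguments.
Unset Strict Implicit.
Unset Printing Implicit Defensive.

Import GRing.Theory.
Local Open Scope ring_scope.

(** Extend a mould M to pairs of words by letting shsum M u v be the sum of M
over the interleavings of u and v. Symetral moulds have the extension
M u * M v and alternal moulds M u * 1 v + 1 u * M v: in Hopf algebra terms,
they are the characters and the infinitesimal characters of the shuffle
algebra. Cutting an interleaving of u and v in two amounts to cutting u and v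
and interleaving the left parts and the right parts (shsum_splits), so the
extension turns products of moulds into convolutions over pairs of splittings
(shsum_mul). Stability under product and conjugation is then a rearrangement
of double sums.

A convolution equation can be solved by induction on the sizes of the words,
so a left inverse of a symetral M, whose extension is the convolution inverse
of M u * M v, is symetral. An explicit left inverse is the antipode
w |-> (-1) ^ |w| M (rev w): the sum that has to vanish telescopes when written
with shsum (alternating_shsum). The antipode of M being symetral, its own
antipode is a left inverse of it; but this is M again, so the inverse is
two-sided.

For composition, let E be alternal and cut an interleaving of u and v into
blocks. Each block is an interleaving of a piece of u and a piece of v; when
both pieces are non-empty, the sum of E over the interleavings is 0, while the
norm of the block does not change since Omega is commutative. Only
interleavings of decompositions of u and of v survive, whence the formula
shsum_comp for the extension of M o E. If M is alternal, all
its terms vanish for non-empty u and v.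
If M o E is the unit for composition, the left-hand side is 0 for non-empty u
and v; by induction all terms but the one of the decompositions into letters
vanish, and this one is shsum M u v times a non-zero scalar. *)

(** * Splittings and shuffles *)

Section SplitsShuffles.

Variable Omega : addSemigroupType.

Implicit Types (w u v : seq Omega).

Fixpoint splits w : seq (seq Omega * seq Omega) :=
  ([::], w) ::
  if w is x :: s then [seq (x :: p.1, p.2) | p <- splits s] else [::].

Lemma splits_size w p : p \in splits w -> size p.1 + size p.2 = size w.
Proof.
elim: w p => [|x s IHs] p; rewrite /= in_cons => /orP[/eqP -> //|] //.
by case/mapP => q /IHs <- ->.
Qed.

Section Sums.

Variable V : nmodType.

Lemma big_splits_cons x s (F : seq Omega * seq Omega -> V) :
  \sum_(p <- splits (x :: s)) F p =
  F ([::], x :: s) + \sum_(p <- splits s) F (x :: p.1, p.2).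
Proof. by rewrite big_cons big_map. Qed.

Lemma big_splits_nil (F : seq Omega * seq Omega -> V) :
  \sum_(p <- splits [::]) F p = F ([::], [::]).
Proof. by rewrite big_seq1. Qed.

Lemma big_splits_head w (F : seq Omega * seq Omega -> V) :
  \sum_(p <- splits w) F p =
  F ([::], w) + \sum_(p <- splits w | p.1 != [::]) F p.
Proof.
case: w => [|x s]; first by rewrite big_splits_nil /= big_cons big_nil addr0.
by rewrite big_splits_cons big_cons big_map.
Qed.

Lemma big_splits_last w (F : seq Omega * seq Omega -> V) :
  \sum_(p <- splits w) F p =
  F (w, [::]) + \sum_(p <- splits w | p.2 != [::]) F p.
Proof.
elim: w F => [|x s IHs] F.
  by rewrite big_splits_nil /= big_cons big_nil addr0.
by rewrite big_splits_cons IHs [in RHS]big_cons big_map addrCA.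
Qed.

Lemma big_splits_ord w (F : seq Omega * seq Omega -> V) :
  \sum_(p <- splits w) F p = \sum_(i < (size w).+1) F (take i w, drop i w).
Proof.
elim: w F => [|x s IHs] F; first by rewrite big_splits_nil big_ord1.
by rewrite big_splits_cons big_ord_recl IHs.
Qed.

(** A decomposition of a non-empty word is a non-empty first block followed by
a decomposition of what remains. *)
Lemma big_decomps w (F : seq (seq Omega) -> V) : w != [::] ->
  \sum_(d <- word_decomps w) F d =
  \sum_(p <- splits w | p.1 != [::])
    \sum_(d <- word_decomps p.2) F (p.1 :: d).
Proof.
elim: w F => [|x s IHs] F // _.
rewrite /= big_cat /= !big_map big_cons big_map /= big_splits_head /=.
congr (_ + _); rewrite big_filter.
case: s IHs => [|y s] IHs;
  first by rewrite /= big_mkcond big_seq1 big_cons big_nil.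
rewrite -(IHs (fun d => F ((x :: head [::] d) :: behead d))) //.
rewrite big_seq_cond [RHS]big_seq; apply: eq_bigl => d.
rewrite mem_word_decomps; case: d => [|a d] //=; by rewrite andbT.
Qed.

Definition shsum (f : seq Omega -> V) u v : V := \sum_(w <- shuffles u v) f w.

Lemma shsum0l f v : shsum f [::] v = f v.
Proof. by case: v => [|y v]; rewrite /shsum big_seq1. Qed.

Lemma shsum0r f u : shsum f u [::] = f u.
Proof. by case: u => [|x u]; rewrite /shsum big_seq1. Qed.

Lemma shsum_cons f x u y v :
  shsum f (x :: u) (y :: v) =
  shsum (fun w => f (x :: w)) u (y :: v) +
  shsum (fun w => f (y :: w)) (x :: u) v.
Proof. by rewrite /shsum big_cat /= !big_map. Qed.

Lemma eq_shsum f g u v : f =1 g -> shsum f u v = shsum g u v.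
Proof. by move=> fg; apply: eq_bigr. Qed.

Lemma shsumD f g u v :
  shsum (fun w => f w + g w) u v = shsum f u v + shsum g u v.
Proof. exact: big_split. Qed.

(** Compatibility of the shuffle product with deconcatenation: both sides obey
the same recursion on the first letters of u and v. *)
Lemma shsum_splits (F : seq Omega -> seq Omega -> V) u v :
  shsum (fun w => \sum_(p <- splits w) F p.1 p.2) u v =
  \sum_(p <- splits u) \sum_(q <- splits v)
     shsum (fun w1 => shsum (F w1) p.2 q.2) p.1 q.1.
Proof.
elim: u v F => [|x u IHu] v F.
  rewrite shsum0l big_splits_nil; apply: eq_bigr => q _.
  by rewrite !shsum0l.
elim: v F => [|y v IHv] F.
  rewrite shsum0r; apply: eq_bigr => p _.
  by rewrite big_splits_nil !shsum0r.
have cons_splits z : (fun s => \sum_(p <- splits (z :: s)) F p.1 p.2) =1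
    fun s => F [::] (z :: s) + \sum_(p <- splits s) F (z :: p.1) p.2.
  by move=> s; rewrite big_splits_cons.
rewrite shsum_cons !(eq_shsum _ _ (cons_splits _)) !shsumD.
rewrite (IHu _ (fun w1 => F (x :: w1))) (IHv (fun w1 => F (y :: w1))).
rewrite addrACA -shsum_cons.
rewrite [in RHS]big_splits_cons big_splits_cons shsum0l -!addrA; congr (_ + _).
rewrite [X in _ + X = _]big_splits_cons.
rewrite addrCA; congr (_ + _).
  by apply: eq_bigr => q _; rewrite !shsum0l.
rewrite -big_split; apply: eq_bigr => p _ /=.
rewrite !big_splits_cons !shsum0r -addrA -big_split; congr (_ + _).
by apply: eq_bigr => q _ /=; rewrite shsum_cons.
Qed.

End Sums.

Lemma mem_shuffles_perm u v w : w \in shuffles u v -> perm_eq w (u ++ v).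
Proof.
elim: u v w => [|x u IHu] v w.
  by case: v => [|y v]; rewrite inE => /eqP ->.
elim: v w => [|y v IHv] w; first by rewrite inE cats0 => /eqP ->.
rewrite /= mem_cat => /orP[] /mapP[s ss ->].
  by rewrite perm_cons IHu.
by rewrite perm_sym (perm_catCA (x :: u) [:: y] v) /= perm_cons perm_sym IHv.
Qed.

End SplitsShuffles.

(** * Symetral and alternal moulds under the product *)

Section MouldShuffles.

Variables (Omega : addSemigroupType) (K : fieldType).

Implicit Types (M N : mould Omega K) (u v w : seq Omega).

Lemma symetral_shsum M u v : symetral M -> shsum M u v = M u * M v.
Proof. by case=> _; apply. Qed.

Lemma symetral_one : symetral (@mould_one Omega K).
Proof.
split=> [//|u v]; rewrite -/(shsum _ u v).
case: u => [|x u]; first by rewrite shsum0l mul1r.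
case: v => [|y v]; first by rewrite shsum0r mulr1.
by rewrite shsum_cons /shsum !big1 ?mul0r ?addr0.
Qed.

Lemma alternal_shsum M u v : alternal M ->
  shsum M u v = M u * mould_one K v + mould_one K u * M v.
Proof.
case=> M0 altM; case: u => [|x u].
  by rewrite shsum0l M0 mul0r add0r mul1r.
case: v => [|y v]; first by rewrite shsum0r M0 mulr0 addr0 mulr1.
by rewrite /shsum altM // mulr0 mul0r addr0.
Qed.

Lemma mould_mul_splits M N w :
  mould_mul M N w = \sum_(p <- splits w) M p.1 * N p.2.
Proof. by rewrite big_splits_ord. Qed.

Lemma mould_mul_nil M N : mould_mul M N [::] = M [::] * N [::].
Proof. by rewrite mould_mul_splits big_splits_nil. Qed.

Lemma shsum_mul M N u v :
  shsum (mould_mul M N) u v =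
  \sum_(p <- splits u) \sum_(q <- splits v)
     shsum M p.1 q.1 * shsum N p.2 q.2.
Proof.
rewrite (eq_shsum _ _ (mould_mul_splits M N)).
rewrite (shsum_splits (fun w1 w2 => M w1 * N w2)).
apply: eq_bigr => p _; apply: eq_bigr => q _.
by rewrite /shsum big_distrlr.
Qed.

Lemma mul_mould_mul M N M' N' u v :
  mould_mul M N u * mould_mul M' N' v =
  \sum_(p <- splits u) \sum_(q <- splits v)
     (M p.1 * M' q.1) * (N p.2 * N' q.2).
Proof.
rewrite !mould_mul_splits big_distrlr; apply: eq_bigr => p _ /=.
by apply: eq_bigr => q _; rewrite mulrACA.
Qed.

Lemma symetral_mul M N : symetral M -> symetral N -> symetral (mould_mul M N).
Proof.
move=> symM symN; split=> [|u v].
  by rewrite mould_mul_nil symM.1 symN.1 mulr1.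
rewrite -/(shsum _ u v) shsum_mul mul_mould_mul.
by apply: eq_bigr => p _; apply: eq_bigr => q _; rewrite !symetral_shsum.
Qed.

(** The extension of B x C is (B x C) u * B v + B u * (B x C) v; multiplying by
B' replaces the factors B by B x B' = 1, which vanishes on non-empty words. *)
Lemma alternal_conj (B C B' : mould Omega K) :
  symetral B -> alternal C -> symetral B' ->
  mould_mul B B' =1 mould_one K ->
  alternal (mould_mul (mould_mul B C) B').
Proof.
move=> symB altC symB' BB'; split=> [|u v nu nv].
  by rewrite !mould_mul_nil altC.1 mulr0 mul0r.
have shBC p q : shsum (mould_mul B C) p q =
    mould_mul B C p * B q + B p * mould_mul B C q.
  have B1 w : mould_mul B (mould_one K) w = B w.
    rewrite mould_mul_splits big_splits_last mulr1 big1 ?addr0 // => r.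
    by rewrite /mould_one => /negPf ->; rewrite mulr0.
  rewrite shsum_mul -(B1 p) -(B1 q) !mul_mould_mul -big_split.
  apply: eq_bigr => r _; rewrite -big_split; apply: eq_bigr => s _ /=.
  by rewrite symetral_shsum // alternal_shsum // mulrDr.
rewrite -/(shsum _ u v) shsum_mul.
transitivity (mould_mul (mould_mul B C) B' u * mould_mul B B' v
              + mould_mul B B' u * mould_mul (mould_mul B C) B' v).
  rewrite !mul_mould_mul -big_split; apply: eq_bigr => r _.
  rewrite -big_split; apply: eq_bigr => s _ /=.
  by rewrite shBC symetral_shsum // mulrDl.
by rewrite !BB' /mould_one (negPf nu) (negPf nv) mulr0 mul0r addr0.
Qed.

(** Solving for the term in which u and v are not cut, whose coefficient is 1,
expresses Z u v by values of Z at strictly smaller pairs. *)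
Lemma convolution_eq0 (Z N : seq Omega -> seq Omega -> K) u v :
  (forall p q, \sum_(r <- splits p) \sum_(s <- splits q)
      Z r.1 s.1 * N r.2 s.2 = 0) ->
  N [::] [::] = 1 -> Z u v = 0.
Proof.
move=> ZN N0; have [n] := ubnP (size u + size v).
elim: n u v => // n IHn u v; rewrite ltnS => le_n.
have := ZN u v; rewrite big_splits_last big_splits_last N0 mulr1.
rewrite big_seq_cond big1 => [|s /andP[/splits_size sz_s s2]]; last first.
  rewrite IHn ?mul0r // (leq_trans _ le_n) // -sz_s ltn_add2l.
  by rewrite -[X in (X < _)%N]addn0 ltn_add2l lt0n size_eq0.
rewrite addr0 big_seq_cond big1 ?addr0 // => r /andP[/splits_size sz_r r2].
rewrite big_seq big1 // => s /splits_size sz_s.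
rewrite IHn ?mul0r // (leq_trans _ le_n) // -sz_r -sz_s.
rewrite addnACA -[X in (X < _)%N]addn0 ltn_add2l.
by rewrite addn_gt0 lt0n size_eq0 r2.
Qed.

(** Both shsum N u v and N u * N v are left inverses of M u * M v for the
convolution, hence they agree. *)
Lemma symetral_left_inverse M N :
  symetral M -> mould_mul N M =1 mould_one K -> symetral N.
Proof.
move=> symM NM; split=> [|u v].
  by have := NM [::]; rewrite mould_mul_nil symM.1 mulr1.
apply/eqP; rewrite -subr_eq0; apply/eqP.
apply: (convolution_eq0 (Z := fun u v => shsum N u v - N u * N v)
          (N := fun u v => M u * M v)) => [p q|]; last by rewrite symM.1 mulr1.
transitivity (shsum (mould_mul N M) p q - mould_mul N M p * mould_mul N M q).
  rewrite shsum_mul mul_mould_mul -sumrB; apply: eq_bigr => r _.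
  rewrite -sumrB; apply: eq_bigr => s _.
  by rewrite mulrBl (symetral_shsum _ _ symM).
by rewrite (eq_shsum _ _ NM) !NM symetral_shsum ?subrr //; apply: symetral_one.
Qed.

(** * The multiplicative inverse of a symetral mould *)

Definition antipode M : mould Omega K := fun w => (-1) ^+ size w * M (rev w).

Lemma antipodeK M : antipode (antipode M) =1 M.
Proof.
by move=> w; rewrite /antipode size_rev revK mulrA -expr2 sqrr_sign mul1r.
Qed.

(** A shuffle of x :: r and y :: w starts with x or with y. By induction, the
terms in which y has moved to the head of the left word add up, with their
sign, to minus the shuffles that start with y; those that start with x
remain. *)
Lemma alternating_shsum M x r w :
  \sum_(p <- splits w) (-1) ^+ size p.1 * shsum M (catrev p.1 (x :: r)) p.2 =
  shsum (fun s => M (x :: s)) r w.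
Proof.
elim: w x r => [|y w IHw] x r.
  by rewrite big_splits_nil mul1r !shsum0r.
rewrite big_splits_cons mul1r shsum_cons.
transitivity (shsum (fun s => M (x :: s)) r (y :: w)
   + shsum (fun s => M (y :: s)) (x :: r) w
   - \sum_(p <- splits w)
       (-1) ^+ size p.1 * shsum M (catrev p.1 (y :: x :: r)) p.2).
  rewrite -sumrN; congr (_ + _); apply: eq_bigr => p _ /=.
  by rewrite exprS mulN1r mulNr.
by rewrite IHw addrK.
Qed.

Lemma antipode_mul M : symetral M -> mould_mul (antipode M) M =1 mould_one K.
Proof.
move=> symM [|x w].
  by rewrite mould_mul_nil /antipode mul1r symM.1 mulr1.
rewrite mould_mul_splits big_splits_cons /antipode mul1r symM.1 mul1r.
transitivity (M (x :: w) - \sum_(p <- splits w)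
    (-1) ^+ size p.1 * shsum M (catrev p.1 [:: x]) p.2).
  rewrite -sumrN; congr (_ + _); apply: eq_bigr => p _ /=.
  by rewrite symetral_shsum // exprS mulN1r !mulNr mulrA.
by rewrite alternating_shsum shsum0l subrr.
Qed.

(** The right inverse comes from antipode_mul applied to the antipode of M. *)
Lemma antipode_inverse M : symetral M -> mould_mul_inverse M (antipode M).
Proof.
move=> symM; have invM := antipode_mul symM; split=> // w.
rewrite -(antipode_mul (symetral_left_inverse symM invM)) !mould_mul_splits.
by apply: eq_bigr => p _; rewrite antipodeK.
Qed.

(** * Composition with an alternal mould *)

(** Since the empty word has no norm, the sum is taken in Omega with a neutral
element None adjoined. *)
Lemma word_normE w :
  word_norm w = \big[oAC (@Algebra.addrA Omega)
                      (@Algebra.addrC Omega)/None]_(x <- w) Some x.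
Proof.
case: w => [|x w]; first by rewrite big_nil.
elim/last_ind: w => [|w y IHw]; first by rewrite big_seq1.
by rewrite -rcons_cons -cats1 big_cat big_seq1 -IHw /= cats1 foldl_rcons.
Qed.

Lemma perm_word_norm u v : perm_eq u v -> word_norm u = word_norm v.
Proof. by move=> uv; rewrite !word_normE; apply: perm_big. Qed.

(** Matches the unfolding of pmap on u :: d, so that the norms of u :: d are
convertible to norm_cons u applied to the norms of d. *)
Definition norm_cons u (s : seq Omega) := oapp (cons^~ s) s (word_norm u).

Lemma mould_comp_splits M N w : w != [::] ->
  mould_comp M N w =
  \sum_(p <- splits w | p.1 != [::])
     N p.1 * mould_comp (fun s => M (norm_cons p.1 s)) N p.2.
Proof.
move=> nw; rewrite /mould_comp big_decomps //; apply: eq_bigr => p _.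
rewrite big_distrr; apply: eq_bigr => d _ /=.
by rewrite big_cons mulrCA.
Qed.

Definition norms d : seq Omega := pmap (@word_norm Omega) d.

Lemma decomps_cons u d : u != [::] -> d \in word_decomps u ->
  exists x t d', d = (x :: t) :: d'.
Proof.
rewrite mem_word_decomps; case: d => [|[|x t] d] nu /andP[/eqP fu] //.
  by case/eqP: nu.
by move=> _; exists x, t, d.
Qed.

Lemma norms_neq0 u d : u != [::] -> d \in word_decomps u -> norms d != [::].
Proof. by move=> nu /(decomps_cons nu)[x [t [e ->]]]. Qed.

(** The vanishing of the mixed blocks: a is constant on the interleavings of p
and q and so factors out of the sum of N over them. *)
Lemma alternal_shsum_nontrivial M N (a : seq Omega -> seq Omega -> K) p q r s :
  alternal N -> p != [::] -> q != [::] ->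
  (forall w, perm_eq w (p ++ q) -> a w =1 a (p ++ q)) ->
  shsum (fun w => shsum (fun t => N w * a w t) r s) p q = 0.
Proof.
move=> [_ altN] np nq aw.
transitivity (shsum N p q * shsum (a (p ++ q)) r s); last first.
  by rewrite /shsum altN ?mul0r.
rewrite /shsum big_distrl; apply: eq_big_seq => w /mem_shuffles_perm wpq /=.
by rewrite big_distrr; apply: eq_bigr => t _ /=; rewrite aw.
Qed.

(** The first block of a surviving decomposition is a prefix of u or a prefix
of v; the mixed ones contribute 0. *)
Lemma shsum_comp_splits M E u v : alternal E -> u != [::] -> v != [::] ->
  shsum (mould_comp M E) u v =
  \sum_(p <- splits u | p.1 != [::])
     E p.1 * shsum (mould_comp (fun s => M (norm_cons p.1 s)) E) p.2 v +
  \sum_(q <- splits v | q.1 != [::])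
     E q.1 * shsum (mould_comp (fun s => M (norm_cons q.1 s)) E) u q.2.
Proof.
move=> altE nu nv.
(* The product with E w is the contribution of the decompositions with first
   block w. *)
pose a w := mould_comp (fun s => M (norm_cons w s)) E.
have a_perm w t : perm_eq w t -> a w =1 a t.
  by move=> wt r; rewrite /a /norm_cons (perm_word_norm wt).
pose G w t := if w != [::] then E w * a w t else 0.
transitivity (shsum (fun w => \sum_(p <- splits w) G p.1 p.2) u v).
  apply: eq_big_seq => w /mem_shuffles_perm /perm_size sz_w.
  rewrite mould_comp_splits -?big_mkcond // -size_eq0 sz_w size_cat addn_eq0.
  by rewrite !size_eq0 negb_and nu.
have Gn w : w != [::] -> G w =1 fun t => E w * a w t by rewrite /G => ->.
rewrite shsum_splits big_splits_head [RHS]addrC /=; congr (_ + _).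
  rewrite big_splits_head /= shsum0l {1}/shsum big1 // add0r.
  apply: eq_bigr => q nq.
  by rewrite !shsum0l /shsum big_distrr; apply: eq_bigr => t _; rewrite Gn.
apply: eq_bigr => p np; rewrite big_splits_head big1 ?addr0 => [|q nq].
  by rewrite !shsum0r /shsum big_distrr; apply: eq_bigr => t _; rewrite Gn.
rewrite -[RHS](@alternal_shsum_nontrivial M E a p.1 q.1 p.2 q.2) //; last first.
  by move=> w /a_perm.
apply: eq_big_seq => w /mem_shuffles_perm /perm_size sz_w.
apply: eq_shsum => t; rewrite Gn // -size_eq0 sz_w size_cat addn_eq0.
by rewrite !size_eq0 negb_and np.
Qed.

(** Iteration of shsum_comp_splits: what remains are the shuffles of a
decomposition of u with a decomposition of v, read as sequences of blocks. *)
Lemma shsum_comp M E u v : alternal E ->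
  shsum (mould_comp M E) u v =
  \sum_(d <- word_decomps u) \sum_(e <- word_decomps v)
     shsum M (norms d) (norms e) * (\prod_(w <- d) E w * \prod_(w <- e) E w).
Proof.
move=> altE; have [n] := ubnP (size u + size v).
elim: n u v M => // n IHn u v M; rewrite ltnS => le_n.
have [->|nu] := eqVneq u [::].
  rewrite shsum0l big_seq1; apply: eq_bigr => e _.
  by rewrite shsum0l big_nil mul1r.
have [->|nv] := eqVneq v [::].
  rewrite shsum0r; apply: eq_bigr => d _.
  by rewrite big_seq1 shsum0r big_nil mulr1.
rewrite shsum_comp_splits //.
(* The shuffles of norms d and norms e are divided according to whether the
   first block comes from d (the sum g) or from e (the sum h). *)
pose g d e := shsum (fun s => M (norm_cons (head [::] d) s))
                (norms (behead d)) (norms e)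
              * (\prod_(w <- d) E w * \prod_(w <- e) E w).
pose h d e := shsum (fun s => M (norm_cons (head [::] e) s))
                (norms d) (norms (behead e))
              * (\prod_(w <- d) E w * \prod_(w <- e) E w).
transitivity (\sum_(d <- word_decomps u) \sum_(e <- word_decomps v) g d e +
              \sum_(e <- word_decomps v) \sum_(d <- word_decomps u) h d e).
  congr (_ + _); rewrite big_decomps // big_seq_cond [RHS]big_seq_cond;
    apply: eq_bigr => p /andP[/splits_size sz_p np]; rewrite IHn.
  - rewrite big_distrr; apply: eq_bigr => d _ /=.
    rewrite big_distrr; apply: eq_bigr => e _ /=.
    by rewrite /g big_cons mulrCA -[in RHS]mulrA.
  - apply: leq_trans le_n; rewrite -sz_p -addnA -[X in (X < _)%N]add0n.
    by rewrite ltn_add2r lt0n size_eq0.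
  - rewrite exchange_big big_distrr; apply: eq_bigr => d _ /=.
    rewrite big_distrr; apply: eq_bigr => e _ /=.
    by rewrite /h big_cons /= mulrCA; congr (_ * _); rewrite mulrCA.
  - apply: leq_trans le_n; rewrite -sz_p ltn_add2l -[X in (X < _)%N]add0n.
    by rewrite ltn_add2r lt0n size_eq0.
rewrite [X in _ + X]exchange_big -big_split; apply: eq_big_seq => d /=.
move=> /(decomps_cons nu)[x [s [d' ->]]].
rewrite -big_split; apply: eq_big_seq => e /=.
move=> /(decomps_cons nv)[y [t [e' ->]]].
by rewrite /g /h -mulrDl [in RHS]/= shsum_cons.
Qed.

Lemma alternal_comp M E : alternal M -> alternal E -> alternal (mould_comp M E).
Proof.
move=> altM altE; split=> [|u v nu nv].
  by rewrite /mould_comp big_seq1 altM.1 mul0r.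
rewrite -/(shsum _ u v) shsum_comp // big_seq big1 // => d du.
rewrite big_seq big1 // => e ev.
by rewrite /shsum altM.2 ?mul0r ?(norms_neq0 nu du) ?(norms_neq0 nv ev).
Qed.

Lemma decomps_size u d : d \in word_decomps u ->
  d = [seq [:: x] | x <- u] \/ (size d < size u)%N.
Proof.
elim: u d => [|x u IHu] d; first by rewrite inE => /eqP ->; left.
rewrite /= mem_cat => /orP[] /mapP[e].
  by move=> /IHu[->|lt_e] ->; [left | right].
rewrite mem_filter => /andP[ne /IHu le_e] ->; right; rewrite /= size_behead.
rewrite prednK ?lt0n ?size_eq0 //.
by case: le_e => [->|/ltnW //]; rewrite size_map.
Qed.

Lemma size_norms d : (size (norms d) <= size d)%N.
Proof. by rewrite size_pmap count_size. Qed.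

Lemma norms_letters u : norms [seq [:: x] | x <- u] = u.
Proof. by elim: u => //= x u ->. Qed.

Lemma letters_decomps u : [seq [:: x] | x <- u] \in word_decomps u.
Proof.
by elim: u => [|x u IHu] //=; rewrite mem_cat map_f.
Qed.

(** Norms of a decomposition form a shorter word unless all blocks are letters.
In the formula for the extension of N o M, which is 0 at non-empty u and v,
induction therefore kills all terms except shsum N u v times the values of M
at the letters, and these are invertible because N o M is 1 on letters. *)
Lemma alternal_left_comp_inverse M N :
  alternal M -> mould_comp N M =1 mould_id K -> alternal N.
Proof.
move=> altM NM; split=> [|u v nu nv].
  by have := NM [::]; rewrite /mould_comp big_seq1 big_nil mulr1.
have M1 w : \prod_(x <- [seq [:: z] | z <- w]) M x != 0.
  rewrite big_map prodf_seq_neq0; apply/allP => x _ /=.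
  have := NM [:: x]; rewrite /mould_comp /= big_seq1 big_seq1 /mould_id /=.
  by apply: contra_eq_neq => ->; rewrite mulr0 eq_sym oner_eq0.
rewrite -/(shsum _ u v); have [n] := ubnP (size u + size v).
elim: n u v nu nv => // n IHn u v nu nv; rewrite ltnS => le_n.
have sh0 : shsum (mould_comp N M) u v = 0.
  rewrite (eq_shsum _ _ NM) /shsum big_seq big1 // => w.
  move=> /mem_shuffles_perm/perm_size; rewrite size_cat /mould_id => ->.
  by case: u v nu nv {le_n} => [|x u] [|y v] //= _ _; rewrite addnS.
have small d e : d \in word_decomps u -> e \in word_decomps v ->
    (size d + size e < size u + size v)%N -> shsum N (norms d) (norms e) = 0.
  move=> du ev lt_de.
  apply: IHn; rewrite ?(norms_neq0 nu du) ?(norms_neq0 nv ev) //.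
  apply: leq_trans le_n; apply: leq_ltn_trans lt_de.
  by rewrite leq_add ?size_norms.
have le_d w d : d \in word_decomps w -> (size d <= size w)%N.
  by move=> /decomps_size[->|/ltnW //]; rewrite size_map.
move: sh0; rewrite shsum_comp //.
rewrite (bigD1_seq [seq [:: x] | x <- u])
  ?letters_decomps ?uniq_word_decomps //=.
rewrite (bigD1_seq [seq [:: x] | x <- v])
  ?letters_decomps ?uniq_word_decomps //=.
rewrite [X in _ + X + _]big_seq_cond [X in _ + X + _]big1
  => [|e /andP[ev ne]]; last first.
  have [/eqP|lt_e] := decomps_size ev; first by rewrite (negPf ne).
  by rewrite small ?letters_decomps ?mul0r // size_map ltn_add2l.
rewrite [X in _ + X]big_seq_cond [X in _ + X]big1
  => [|d /andP[du nd]]; last first.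
  have [/eqP|lt_d] := decomps_size du; first by rewrite (negPf nd).
  rewrite big_seq big1 // => e ev; rewrite small ?mul0r //.
  by rewrite -addSn leq_add ?le_d.
rewrite !addr0 !norms_letters => /eqP.
by rewrite !mulf_eq0 !(negPf (M1 _)) !orbF => /eqP.
Qed.

End MouldShuffles.

Theorem mainTheorem6 (Omega : addSemigroupType) (K : fieldType)
    (charK0 : [pchar K] =i pred0) (A B C E : mould Omega K)
    (symA : symetral A) (symB : symetral B)
    (altC : alternal C) (altE : alternal E) :
  [/\ (exists A' : mould Omega K, mould_mul_inverse A A') /\
      (forall A' : mould Omega K, mould_mul_inverse A A' -> symetral A'),
      (forall C' : mould Omega K, mould_comp_inverse C C' -> alternal C'),
      symetral (mould_mul A B),
      alternal (mould_comp C E)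
    & (forall B' : mould Omega K, mould_mul_inverse B B' ->
        alternal (mould_mul (mould_mul B C) B'))].
Proof.
split.
- split; first by exists (antipode A); apply: antipode_inverse.
  by move=> A' [_]; apply: symetral_left_inverse.
- by move=> C' [_]; apply: alternal_left_comp_inverse.
- exact: symetral_mul.
- exact: alternal_comp.
- move=> B' [BB' B'B]; apply: alternal_conj => //.
  exact: symetral_left_inverse B'B.
Qed.
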